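(* Any $M\times N$ unit norm frame $\Phi$ with the strong coherence property satisfies the $\left(K,\delta,\frac{4K}{N^2}\right)$-weak restricted isometry property provided $N\ge128$ and $2K\log N\le\min\left\{\frac{\delta^2}{100\mu^2},M\right\}$, where $\mu$ is the worst-case coherence of $\Phi$.
   Context: $\log$ is the natural logarithm. A unit norm frame is an $M\times N$ real or complex matrix $\Phi=[\varphi_1\cdots\varphi_N]$ of rank $M$ ($N\ge M$) with unit-norm columns. Its worst-case coherence is $\mu:=\max_{i\ne j}|\langle\varphi_i,\varphi_j\rangle|$ and its average coherence is $\nu:=\max_i\left|\frac1{N-1}\sum_{j\ne i}\langle\varphi_i,\varphi_j\rangle\right|$. It satisfies the strong coherence property if $\mu\le\frac1{164\log N}$ and $\nu\le\frac{\mu}{\sqrt M}$. An $M\times N$ frame $\Phi$ satisfies the $(K,\delta,p)$-weak restricted isometry property if for every $y\in\mathbb C^N$ with at most $K$ nonzero entries, a (uniformly) random permutation $x$ of $y$'s entries satisfies $(1-\delta)\|x\|^2\le\|\Phi x\|^2\le(1+\delta)\|x\|^2$ with probability exceeding $1-p$. *)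

(* Defs.v *)
From HB Require Import structures.
From mathcomp Require Import all_boot all_order all_algebra perm.
From mathcomp Require Import complex.
From mathcomp Require Import constructive_ereal reals exp.
Set Implicit Arguments.
Unset Strict Implicit.
Unset Printing Implicit Defensive.
Import Order.TTheory GRing.Theory Num.Theory.
Local Open Scope ring_scope.

(* Scalars are R[i] with R : realType; real matrices are the complex matrices
   with real entries (same rank, norms and inner products). *)

Definition cmod (R : realType) (z : R[i]) : R := ComplexField.Normc.normc z.

Definition inner (R : realType) (n : nat) (u v : 'cV[R[i]]_n) : R[i] :=
  \sum_(k < n) u k 0 * (v k 0)^*.

Definition norm2 (R : realType) (n : nat) (v : 'cV[R[i]]_n) : R :=
  Num.sqrt (\sum_(k < n) cmod (v k 0) ^+ 2).

Definition unit_norm_frame (R : realType) (M N : nat) (Phi : 'M[R[i]]_(M, N))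
  : Prop :=
  [/\ (M <= N)%N, \rank Phi = M & forall i : 'I_N, norm2 (col i Phi) = 1].

(* The quantities maximized are nonnegative, so the default value 0 of the
   maximum only matters over an empty range. *)
Definition worst_case_coherence (R : realType) (M N : nat)
    (Phi : 'M[R[i]]_(M, N)) : R :=
  \big[Num.max/0]_(ij : 'I_N * 'I_N | ij.1 != ij.2)
    cmod (inner (col ij.1 Phi) (col ij.2 Phi)).

Definition average_coherence (R : realType) (M N : nat)
    (Phi : 'M[R[i]]_(M, N)) : R :=
  \big[Num.max/0]_(i < N)
    cmod ((N.-1)%:R^-1 * \sum_(j < N | j != i) inner (col i Phi) (col j Phi)).

Definition strong_coherence (R : realType) (M N : nat)
    (Phi : 'M[R[i]]_(M, N)) : Prop :=
  worst_case_coherence Phi <= 1 / (164 * ln N%:R) /\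
  average_coherence Phi <= worst_case_coherence Phi / Num.sqrt M%:R.

Definition uniform_prob (R : realType) (T : finType) (E : {set T}) : R :=
  #|E|%:R / #|T|%:R.

Definition weak_RIP (R : realType) (M N : nat) (Phi : 'M[R[i]]_(M, N))
    (K : nat) (delta p : R) : Prop :=
  forall y : 'cV[R[i]]_N,
    (#|[set i : 'I_N | (y i 0 != 0)%R]| <= K)%N ->
    1 - p < uniform_prob R
      [set s : 'S_N | let x := row_perm s y in
        (1 - delta) * norm2 x ^+ 2 <= norm2 (Phi *m x) ^+ 2
          <= (1 + delta) * norm2 x ^+ 2].

(* min {delta^2 / (100 mu^2), M}, with the quotient taken in the extended reals,
   where 0^-1 = +oo: when mu = 0 and delta > 0 the first term is +oo and imposes
   no constraint (real division would make it 0 instead). *)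
Definition sparsity_bound (R : realType) (M N : nat) (Phi : 'M[R[i]]_(M, N))
    (delta : R) : \bar R :=
  mine ((delta ^+ 2)%:E / (100 * worst_case_coherence Phi ^+ 2)%:E)%E
       (M%:R)%:E.

(* Main.v *)
Require Import Defs.
From mathcomp Require Import all_boot all_order all_algebra fingroup perm.
From mathcomp Require Import complex.
From mathcomp Require Import constructive_ereal reals sequences exp.
From mathcomp Require Import ring lra zify.
Import Order.TTheory GRing.Theory Num.Theory.
Local Open Scope ring_scope.

(** Write [mu] for the worst-case coherence, [y] for a vector with at most [K]
    nonzero entries, and let a random permutation [s] send the entry [y l] to
    the column [s l] of [Phi].  Since the columns have norm 1, the energy of the
    image differs from the energy of [y] only by the cross terms
    [\sum_k (y k)^* * I_k], where the interference [I_k] is the sum over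
    [l != k] of [y l] times the inner product of the columns [s l] and [s k]
    ([energy_expand]).  By Cauchy-Schwarz, it is enough that
    [|I_k| <= 10 * ell * mu * norm2 y] for every [k] in the support, where
    [ell = sqrt (2 * ln N)]: the total deviation is then at most
    [10 * ell * mu * sqrt K] times the energy, and the sparsity hypothesis says
    precisely that this factor is at most [delta] ([energy_deviation_le]).

    Fix [k] and condition on [s k = t].  The real part of [I_k] times a unit
    scalar is then a linear statistic [\sum_l a_l (s l)] of a random injection
    into the columns other than [t].  Its mean is controlled by the average
    coherence, and is at most [mu * norm2 y / ell].  Its fluctuations are
    controlled by an Azuma-type argument ([sum_expR_agreeing]): the values [s l]
    are exposed one at a time, and exposing [s l = t] changes the conditional
    mean of the statistic by [g t] minus the average of [g], where
    [g = a_l - (\sum_l' a_l') / (n - 1)] with [n] the number of columns that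
    were still free and [l'] ranging over the points not yet exposed.  The
    correction term accounts for the removal of [t] from the population of the
    later draws; it is small because [K <= N / 8].  The moment generating
    function thus grows at each step by a Gaussian factor, and the exponential
    Markov inequality bounds the tail by less than [exp (- ell^2) = 1 / N^2]
    ([linear_statistic_tail], [interference_tail]).

    A complex number of modulus greater than [10 * c] has a real part greater
    than [7 * c] after multiplication by one of [1, -1, 'i, - 'i]
    ([cmod_le_phases]); the union bound over these four scalars and over the
    support, of size at most [K], gives the failure probability [4 * K / N^2]. *)

(** * Exposing the values of a random permutation *)
Definition agreeing {T : finType} (J : {set T}) (s0 : {perm T}) :
    {set {perm T}} :=
  [set s : {perm T} | [forall j in J, s j == s0 j]].

(** These permutations form a coset of the pointwise stabilizer of [J]. *)
Lemma card_agreeing {T : finType} (J : {set T}) (s0 : {perm T}) :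
  #|agreeing J s0| = #|~: J|`!.
Proof.
rewrite -card_perm -(card_imset (mem (perm_on (~: J))) (@mulIg _ s0)).
apply: eq_card => s; apply/idP/imsetP => [|[u uJ ->]].
  rewrite inE => /forall_inP ss0; exists (s * s0^-1)%g; last by rewrite mulgKV.
  apply/subsetP => x; rewrite !inE; apply: contraNN => xJ.
  by rewrite permM (eqP (ss0 x xJ)) permK.
rewrite inE; apply/forall_inP => j jJ.
by rewrite permM (out_perm uJ) // inE jJ.
Qed.

(** Conditioning on the value [t] at one more point [l]: composing [s0] with the
    transposition of [s0 l] and [t] realizes this value without disturbing the
    values on [J], precisely because [t] is not one of them. *)
Lemma big_agreeing_expose {R : realType} {T : finType} (J : {set T})
    (s0 : {perm T}) (l : T) (F : {perm T} -> R) : l \notin J ->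
  \sum_(s in agreeing J s0) F s =
  \sum_(t in ~: (s0 @: J))
     \sum_(s in agreeing (l |: J) (s0 * tperm (s0 l) t)%g) F s.
Proof.
move=> lJ.
rewrite (partition_big (fun s : {perm T} => s l) (mem (~: (s0 @: J)))) /=.
  apply: eq_bigr => t tJ; apply: eq_bigl => s; rewrite !inE.
  have st j : j \in J -> (s0 * tperm (s0 l) t)%g j = s0 j.
    move=> jJ; rewrite permM tpermD //.
      by rewrite (inj_eq perm_inj); apply: contraNneq lJ => ->.
    by apply: contraTneq tJ => ->; rewrite inE negbK imset_f.
  apply/andP/forall_inP => [[/forall_inP sJ /eqP sl] j|sJ].
    rewrite !inE => /orP[/eqP ->|jJ]; first by rewrite permM tpermL sl.
    by rewrite st // sJ.
  split; last by rewrite (eqP (sJ l (setU11 _ _))) permM tpermL.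
  apply/forall_inP => j jJ; rewrite (eqP (sJ j _)) ?st //.
  by rewrite !inE jJ orbT.
move=> s; rewrite !inE => /forall_inP sJ; apply/imsetP => -[j jJ].
rewrite -(eqP (sJ j jJ)) => /perm_inj lj.
by rewrite lj jJ in lJ.
Qed.

Lemma compl_expose {T : finType} (J : {set T}) (s0 : {perm T}) (l t : T) :
  l \notin J -> t \in ~: (s0 @: J) ->
  ~: ((s0 * tperm (s0 l) t)%g @: (l |: J)) = ~: (s0 @: J) :\ t.
Proof.
move=> lJ tJ; rewrite imsetU1 permM tpermL setCU setIC -setDE.
congr (~: _ :\ _); apply: eq_in_imset => j jJ; rewrite permM tpermD //.
  by rewrite (inj_eq perm_inj); apply: contraNneq lJ => ->.
by apply: contraTneq tJ => ->; rewrite inE negbK imset_f.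
Qed.

(** * Moment generating function of a linear statistic *)

(** The one-variable sub-Gaussian estimate: the linear term averages to zero for
    a centred variable.  For [x <= 1/2] the exponential is at
    most [1 / (1 - x) <= 1 + x + 2 * x ^+ 2]; for larger [x] one has
    [x <= 2 * x ^+ 2]. *)
Lemma expR_le_quadratic {R : realType} (x : R) :
  expR x <= x + expR (2 * x ^+ 2).
Proof.
have [x_small|x_large] := lerP x (1 / 2); last first.
  have : expR x <= expR (2 * x ^+ 2) by rewrite ler_expR; nra.
  lra.
have e1 : 1 + 2 * x ^+ 2 <= expR (2 * x ^+ 2) by exact: expR_ge1Dx.
have e2 : 1 - x <= expR (- x) by exact: expR_ge1Dx.
have e3 := expRxMexpNx_1 x; have e4 := expR_gt0 x.
have e5 : expR x * (1 - x) <= 1 by rewrite -[leRHS]e3 ler_pM2l.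
nra.
Qed.

Definition average {R : realType} {T : finType} (A : {set T}) (f : T -> R)
    : R :=
  (\sum_(t in A) f t) / #|A|%:R.

Lemma average_deviation_le {R : realType} {T : finType} (A : {set T})
    (f : T -> R) (c : R) (t : T) : t \in A ->
  (forall u, u \in A -> `|f u| <= c) -> `|f t - average A f| <= 2 * c.
Proof.
move=> tA fc.
have A0 : 0 < #|A|%:R :> R by rewrite ltr0n card_gt0; apply/set0Pn; exists t.
have : `|average A f| <= c.
  rewrite /average normrM normfV (ger0_norm (ltW A0)) ler_pdivrMr //.
  rewrite (le_trans (ler_norm_sum _ _ _)) // (le_trans (ler_sum _ fc)) //.
  by rewrite sumr_const mulr_natr.
have := fc t tA; have := ler_normB (f t) (average A f); lra.
Qed.

(** The constant is [2 * 2 ^+ 2]: the factor [2] of [expR_le_quadratic], applied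
    to deviations of size at most [2 * c]. *)
Lemma sum_expR_centered {R : realType} {T : finType} (A : {set T})
    (f : T -> R) (c : R) : (forall t, t \in A -> `|f t| <= c) ->
  \sum_(t in A) expR (f t - average A f) <= #|A|%:R * expR (8 * c ^+ 2).
Proof.
move=> fc; have [->|[t0 t0A]] := set_0Vmem A.
  by rewrite big_set0 cards0 mul0r.
have A0 : #|A|%:R != 0 :> R.
  by rewrite pnatr_eq0 -lt0n card_gt0; apply/set0Pn; exists t0.
have -> : #|A|%:R * expR (8 * c ^+ 2) =
    \sum_(t in A) (f t - average A f + expR (8 * c ^+ 2)).
  rewrite 2!big_split /= sumrN !sumr_const /average.
  by rewrite -[(_ / _) *+ _]mulr_natr divfK // subrr add0r mulr_natl.
apply: ler_sum => t tA; apply: le_trans (expR_le_quadratic _) _.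
rewrite lerD2l ler_expR; have := average_deviation_le _ _ _ _ tA fc.
move=> h; have : (f t - average A f) ^+ 2 <= (2 * c) ^+ 2.
  rewrite -[leLHS]real_normK ?num_real // lerXn2r // ?nnegrE //.
  exact: le_trans h.
lra.
Qed.

(** Removing the drawn element [t] moves the mean of the remaining population
    away from [f t]; this is the drift that the later draws feel. *)
Lemma average_setD1 {R : realType} {T : finType} (A : {set T}) (f : T -> R)
    (t : T) : t \in A -> (1 < #|A|)%N ->
  average (A :\ t) f = average A f + (average A f - f t) / #|A :\ t|%:R.
Proof.
move=> tA A1; rewrite /average (big_setD1 t tA) /=.
have := cardsD1 t A; rewrite tA add1n => ->.
have : (0 < #|A :\ t|)%N by have := cardsD1 t A; rewrite tA; lia.
set n := #|_| => n0.
have : n%:R != 0 :> R by rewrite pnatr_eq0 -lt0n.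
have : n.+1%:R != 0 :> R by rewrite pnatr_eq0.
rewrite -natr1 => h1 h2; field.
by apply/andP.
Qed.

(** The Azuma-type bound, by induction on the points still to be exposed.  Given
    the first value [s l = t], the induction hypothesis bounds the rest by its
    conditional mean, which depends on [t] through [average_setD1].  Collecting
    this dependence, the exponent becomes the unconditional mean plus
    [g t - average A g], and [sum_expR_centered] disposes of the average over
    [t].  The number [b] is a uniform bound on the drift part of [g]; its
    hypothesis is inherited by the tail of [L], since exposing a point lowers
    both cardinals by one. *)
Lemma sum_expR_agreeing {R : realType} {T : finType} (L : seq T) (J : {set T})
    (s0 : {perm T}) (f : T -> T -> R) (m : T -> R) (b : R) :
  uniq L -> {in L, forall l, l \notin J} -> 0 <= b ->
  \sum_(l <- L) m l <= b * (#|~: J|%:R - (size L)%:R) ->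
  {in L & ~: (s0 @: J), forall l t, `|f l t| <= m l} ->
  \sum_(s in agreeing J s0) expR (\sum_(l <- L) f l (s l)) <=
  #|~: J|`!%:R *
    expR (\sum_(l <- L) (average (~: (s0 @: J)) (f l) + 8 * (m l + b) ^+ 2)).
Proof.
elim: L J s0 => [|l L IH] J s0 /= => [_ _ _ _ _|/andP[lL uL] LJ b0 bL fm].
  under eq_bigr do rewrite big_nil.
  by rewrite big_nil sumr_const card_agreeing mulr_natl expR0.
have lJ : l \notin J by rewrite LJ ?mem_head.
set A := ~: (s0 @: J) in fm *; set n := #|~: J|.
have cA : #|A| = n.
  have := cardsC J; have := cardsC (s0 @: J).
  by rewrite card_imset -/A -/n; [lia | exact: perm_inj].
have cJ : #|~: (l |: J)| = n.-1.
  have := cardsC J; have := cardsC (l |: J); rewrite cardsU1 lJ /n; lia.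
have cAD t : t \in A -> #|A :\ t| = n.-1.
  by move=> tA; have := cardsD1 t A; rewrite cA tA => ->.
have nL : (size L < n)%N.
  rewrite /n cardE -[leqLHS]/(size (l :: L)); apply: uniq_leq_size.
    by rewrite /= lL.
  by move=> j /LJ; rewrite mem_enum inE.
have n1 : {in L, forall l', (1 < n)%N}.
  by move=> l'; case: (L) nL => //= ? ? /(leq_trans _) -> .
rewrite (big_agreeing_expose J s0 l) // -/A.
pose g t := f l t - (\sum_(l' <- L) f l' t) / n.-1%:R.
have avg_g : average A g =
    average A (f l) - (\sum_(l' <- L) average A (f l')) / n.-1%:R.
  rewrite /g /average sumrB mulrBl; congr (_ - _).
  by rewrite -!mulr_suml exchange_big mulrAC.
(* The drift is at most [b * (n - size (l :: L)) / (n - 1) <= b]. *)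
have g_le t : t \in A -> `|g t| <= m l + b.
  move=> tA; apply: le_trans (ler_normB _ _) _; apply: lerD.
    by apply: fm; rewrite ?mem_head.
  have [->|[l' l'L]] : L = [::] \/ exists l', l' \in L.
  - by case: (L) => [|l' L']; [left | right; exists l'; exact: mem_head].
  - by rewrite big_nil mul0r normr0.
  have n0 : 0 < n.-1%:R :> R by rewrite ltr0n; have := n1 _ l'L; lia.
  rewrite normrM normfV (gtr0_norm n0) ler_pdivrMr //.
  apply: le_trans (ler_norm_sum _ _ _) _.
  apply: (@le_trans _ _ (\sum_(l' <- L) m l')).
    rewrite big_seq [leRHS]big_seq; apply: ler_sum => j jL.
    by apply: fm; rewrite // inE jL orbT.
  have ml : 0 <= m l by apply: le_trans (fm l t _ tA); rewrite ?mem_head.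
  have := bL; rewrite big_cons.
  have : n%:R = n.-1%:R + 1 :> R by rewrite natr1; congr _%:R; lia.
  rewrite /= -natr1; have : 0 <= (size L)%:R :> R by [].
  set N := n%:R; set N' := n.-1%:R; set k := (size L)%:R; nra.
set V := \sum_(l' <- L) 8 * (m l' + b) ^+ 2.
set E := \sum_(l' <- l :: L) average A (f l').
(* Each fibre over [s l = t] satisfies the bound of the induction hypothesis,
   whose [t]-dependence is isolated in the last factor. *)
have step t : t \in A ->
   \sum_(s in agreeing (l |: J) (s0 * tperm (s0 l) t)%g)
      expR (\sum_(l' <- l :: L) f l' (s l')) <=
   n.-1`!%:R * expR (E + V) * expR (g t - average A g).
  move=> tA.
  have -> : \sum_(s in agreeing (l |: J) (s0 * tperm (s0 l) t)%g)
      expR (\sum_(l' <- l :: L) f l' (s l')) = expR (f l t) *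
      \sum_(s in agreeing (l |: J) (s0 * tperm (s0 l) t)%g)
      expR (\sum_(l' <- L) f l' (s l')).
    rewrite mulr_sumr; apply: eq_bigr => s; rewrite inE => /forall_inP sJ.
    by rewrite big_cons expRD (eqP (sJ l (setU11 _ _))) permM tpermL.
  have := IH (l |: J) (s0 * tperm (s0 l) t)%g uL.
  rewrite compl_expose // -/A cJ => IHt.
  apply: le_trans (_ : expR (f l t) * (n.-1`!%:R * expR (\sum_(l' <- L)
     (average (A :\ t) (f l') + 8 * (m l' + b) ^+ 2))) <= _).
    rewrite ler_pM2l ?expR_gt0 //; apply: IHt => //.
    - move=> j jL; rewrite !inE negb_or LJ ?inE ?jL ?orbT // andbT.
      by apply: contraNneq lL => <-.
    - move: bL; rewrite big_cons.
      have ml : 0 <= m l by apply: le_trans (fm l t _ tA); rewrite ?mem_head.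
      have : n%:R = n.-1%:R + 1 :> R by rewrite natr1; congr _%:R; lia.
      rewrite /= -natr1; set N := n%:R; set N' := n.-1%:R; nra.
    - by move=> j u jL; rewrite inE => /andP[_ uA]; apply: fm;
         rewrite // inE jL orbT.
  rewrite mulrCA -!mulrA ler_pM2l ?ltr0n ?fact_gt0 // -!expRD ler_expR.
  rewrite big_split /= -/V avg_g /g /E big_cons.
  suff -> : \sum_(l' <- L) average (A :\ t) (f l') =
     \sum_(l' <- L) average A (f l') +
     ((\sum_(l' <- L) average A (f l')) - \sum_(l' <- L) f l' t) / n.-1%:R.
    by rewrite le_eqVlt; apply/orP; left; apply/eqP; ring.
  rewrite -sumrB mulr_suml -big_split /= big_seq [RHS]big_seq.
  by apply: eq_bigr => j jL; rewrite average_setD1 ?cAD // cA (n1 j).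
apply: le_trans (ler_sum _ step) _; rewrite -mulr_sumr.
apply: le_trans (_ : n.-1`!%:R * expR (E + V) *
   (#|A|%:R * expR (8 * (m l + b) ^+ 2)) <= _).
  rewrite ler_pM2l ?mulr_gt0 ?expR_gt0 ?ltr0n ?fact_gt0 //.
  exact: sum_expR_centered.
rewrite big_split /= -/E big_cons -/V cA.
have -> : n`!%:R = n%:R * n.-1`!%:R :> R.
  have n0 : (0 < n)%N := leq_ltn_trans (leq0n _) nL.
  by rewrite -natrM -[in LHS](prednK n0) factS prednK.
rewrite addrCA addrA [E + _]addrC -addrA !expRD.
by rewrite le_eqVlt; apply/orP; left; apply/eqP; ring.
Qed.

(** * Tail of a linear statistic *)

(** Exponential Markov inequality, with [lam] the tilting parameter.  The
    coefficients may depend on [s k]: the bound holds conditionally on every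
    value [t] of [s k], and the draws [s l] then avoid [t], so only the values
    [a l u t] with [u != t] matter. *)
Lemma linear_statistic_tail {R : realType} {T : finType} (L : seq T) (k : T)
    (a : T -> T -> T -> R) (m h : T -> R) (b lam thr : R) :
  uniq L -> k \notin L -> 0 <= b -> 0 <= lam ->
  \sum_(l <- L) m l <= b * (#|T|%:R - 1 - (size L)%:R) ->
  {in L, forall l u t, u != t -> `|a l u t| <= m l} ->
  {in L, forall l t, average (~: [set t]) (a l ^~ t) <= h l} ->
  #|[set s : {perm T} | thr < \sum_(l <- L) a l (s l) (s k)]|%:R <=
  #|{perm T}|%:R * expR (lam * (\sum_(l <- L) h l - thr) +
     8 * lam ^+ 2 * \sum_(l <- L) (m l + b) ^+ 2).
Proof.
move=> uL kL b0 lam0 bL am ah.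
set stat := fun s : {perm T} => \sum_(l <- L) a l (s l) (s k).
have cT1 : #|~: [set k]| = #|T|.-1 by rewrite cardsC1.
have cT : (0 < #|T|)%N by apply/card_gt0P; exists k.
apply: (@le_trans _ _ (expR (- (lam * thr)) *
    \sum_(s in agreeing set0 (1%g : {perm T})) expR (lam * stat s))).
  rewrite mulr_sumr -sum1_card natr_sum big_mkcond [leRHS]big_mkcond /=.
  apply: ler_sum => s _; rewrite !inE.
  have -> : [forall j in set0, s j == (1%g : {perm T}) j].
    by apply/forall_inP => j; rewrite inE.
  rewrite -expRD; case: ifP => [lt_s|_]; last exact: expR_ge0.
  apply: le_trans (expR_ge1Dx _); have : thr < stat s by [].
  nra.
(* Conditioning on [s k = t]. *)
rewrite (big_agreeing_expose _ _ k) ?inE // imset0 setC0.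
under eq_bigr => t _ do rewrite perm1 mul1g setU0.
set E := expR (_ + _).
have -> : #|{perm T}|%:R = #|T|%:R * #|T|.-1`!%:R :> R.
  have -> : #|{perm T}| = #|T|`!.
    have := card_perm [set: T]; rewrite cardsT => <-; apply: eq_card => s.
    by apply/esym/subsetP => x; rewrite inE.
  by rewrite -natrM -[in LHS](prednK cT) factS prednK.
rewrite mulr_sumr mulrAC -mulrA.
have -> : #|T|%:R * (E * #|T|.-1`!%:R) =
    \sum_(t in [set: T]) (#|T|.-1`!%:R * E).
  by rewrite sumr_const cardsT mulr_natl mulrC.
apply: ler_sum => t _.
have ktE : ~: (tperm k t @: [set k]) = ~: [set t].
  by rewrite imset_set1 tpermL.
have -> : \sum_(s in agreeing [set k] (tperm k t)) expR (lam * stat s) =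
    \sum_(s in agreeing [set k] (tperm k t))
      expR (\sum_(l <- L) lam * a l (s l) t).
  apply: eq_bigr => s; rewrite inE => /forall_inP /(_ k (set11 _)) /eqP sk.
  by rewrite /stat sk tpermL mulr_sumr.
have := sum_expR_agreeing L [set k] (tperm k t) (fun l u => lam * a l u t)
  (fun l => lam * m l) (lam * b) uL.
rewrite cT1 ktE => tail.
apply: le_trans (ler_wpM2l (expR_ge0 _) (tail _ _ _ _)) _.
- by move=> l lL; rewrite inE; apply: contraNneq kL => <-.
- exact: mulr_ge0.
- rewrite -mulr_sumr -mulrA ler_wpM2l //.
  by rewrite -subn1 natrB.
- move=> l u lL; rewrite !inE => ut; rewrite normrM (ger0_norm lam0).
  by rewrite ler_wpM2l // am.
rewrite mulrCA -expRD ler_pM2l ?ltr0n ?fact_gt0 // ler_expR.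
rewrite big_split /= mulrBr addrA addrC -addrA [leRHS]addrC.
rewrite [X in _ <= X + _]addrC -!addrA.
have -> : \sum_(l <- L) 8 * (lam * m l + lam * b) ^+ 2 =
   8 * lam ^+ 2 * \sum_(l <- L) (m l + b) ^+ 2.
  by rewrite mulr_sumr; apply: eq_bigr => l _; ring.
have : \sum_(l <- L) average (~: [set t]) (fun u => lam * a l u t) <=
    lam * \sum_(l <- L) h l.
  rewrite mulr_sumr big_seq [leRHS]big_seq; apply: ler_sum => l lL.
  by rewrite /average -mulr_sumr -mulrA ler_wpM2l // ah.
lra.
Qed.

(** * Moduli, norms and inner products *)

Import ComplexField.Normc.
Local Open Scope complex_scope.

Lemma cmod_ge0 {R : realType} (z : R[i]) : 0 <= cmod z.
Proof. by case: z => a b; exact: sqrtr_ge0. Qed.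

Lemma cmod_sqr {R : realType} (z : R[i]) :
  cmod z ^+ 2 = complex.Re z ^+ 2 + complex.Im z ^+ 2.
Proof. by case: z => a b /=; rewrite sqr_sqrtr // addr_ge0 ?sqr_ge0. Qed.

Lemma cmodM {R : realType} (z w : R[i]) : cmod (z * w) = cmod z * cmod w.
Proof. exact: normcM. Qed.

Lemma cmod_sum {R : realType} {I : Type} (r : seq I) (P : pred I)
    (F : I -> R[i]) :
  cmod (\sum_(i <- r | P i) F i) <= \sum_(i <- r | P i) cmod (F i).
Proof.
apply: (big_ind2 (fun z x => cmod z <= x)) => //.
  by rewrite /cmod normc0.
move=> z x w x' zx wx'; apply: le_trans (lerD zx wx').
exact: le_normcD.
Qed.

Lemma cmod_real {R : realType} (x : R) : cmod x%:C = `|x|.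
Proof. by rewrite /cmod /= expr0n addr0 sqrtr_sqr. Qed.

Lemma Re_sum {R : realType} {I : Type} (r : seq I) (P : pred I)
    (F : I -> R[i]) :
  complex.Re (\sum_(i <- r | P i) F i) = \sum_(i <- r | P i) complex.Re (F i).
Proof. by apply: big_morph => // -[a b] [c d]. Qed.

Lemma Re_le_cmod {R : realType} (z : R[i]) : `|complex.Re z| <= cmod z.
Proof.
rewrite -(ler_pXn2r (n := 2)) ?nnegrE ?cmod_ge0 //.
by rewrite cmod_sqr real_normK ?num_real // lerDl sqr_ge0.
Qed.

Lemma cmod_conj {R : realType} (z : R[i]) : cmod (z^*)%R = cmod z.
Proof. by case: z => a b; rewrite /cmod /= sqrrN. Qed.

Lemma conjE {R : realType} (z : R[i]) : (z^*)%R = conjc z.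
Proof. by []. Qed.

Lemma mul_conj {R : realType} (z : R[i]) : z * (z^*)%R = (cmod z ^+ 2)%:C.
Proof.
rewrite cmod_sqr; case: z => a b; rewrite conjE; simpc.
by congr (_ +i* _); ring.
Qed.

Lemma norm2_sqr {R : realType} {n : nat} (v : 'cV[R[i]]_n) :
  norm2 v ^+ 2 = \sum_(k < n) cmod (v k 0) ^+ 2.
Proof. by rewrite sqr_sqrtr // sumr_ge0 // => k _; rewrite sqr_ge0. Qed.

Lemma inner_self {R : realType} {n : nat} (v : 'cV[R[i]]_n) :
  inner v v = (norm2 v ^+ 2)%:C.
Proof.
rewrite norm2_sqr (raddf_sum (real_complex R)) /=.
by apply: eq_bigr => k _; rewrite mul_conj.
Qed.

Lemma norm2_row_perm {R : realType} {n : nat} (s : 'S_n) (v : 'cV[R[i]]_n) :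
  norm2 (row_perm s v) = norm2 v.
Proof.
rewrite /norm2 [in RHS](reindex_inj (@perm_inj _ s)) /=.
by congr Num.sqrt; apply: eq_bigr => k _; rewrite mxE.
Qed.

(** * Energy of the image of a permuted vector *)

Definition interference {R : realType} {M N : nat} (Phi : 'M[R[i]]_(M, N))
    (y : 'cV[R[i]]_N) (s : 'S_N) (k : 'I_N) : R[i] :=
  \sum_(l < N | l != k) y l 0 * inner (col (s l) Phi) (col (s k) Phi).

(** The inverse permutation appears because [row_perm s^-1 y] places the entry
    [y l] in position [s l], so that it multiplies the column [s l] of [Phi].
    The diagonal terms of the Gram expansion are the energy of [y]. *)
Lemma energy_expand {R : realType} {M N : nat} (Phi : 'M[R[i]]_(M, N))
    (y : 'cV[R[i]]_N) (s : 'S_N) :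
  (forall i : 'I_N, norm2 (col i Phi) = 1) ->
  (norm2 (Phi *m row_perm s^-1 y) ^+ 2 - norm2 y ^+ 2)%:C =
  \sum_(k < N) (y k 0)^*%R * interference Phi y s k.
Proof.
move=> unit_Phi.
rewrite rmorphB /= -inner_self norm2_sqr (raddf_sum (real_complex R)) /=.
have Phi_x k : (Phi *m row_perm s^-1 y) k 0 =
    \sum_(l < N) y l 0 * Phi k (s l).
  rewrite mxE (reindex_inj (@perm_inj _ s)) /=.
  by apply: eq_bigr => l _; rewrite mxE permK mulrC.
have -> : inner (Phi *m row_perm s^-1 y) (Phi *m row_perm s^-1 y) =
    \sum_(k < N) (y k 0)^*%R * 
     \sum_(l < N) y l 0 * inner (col (s l) Phi) (col (s k) Phi).
  transitivity (\sum_(i < M) \sum_(k < N) \sum_(l < N)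
      (y k 0)^*%R * (y l 0 * (Phi i (s l) * (Phi i (s k))^*%R))).
    apply: eq_bigr => i _; rewrite !Phi_x rmorph_sum mulr_sumr.
    apply: eq_bigr => k _; rewrite mulr_suml.
    by apply: eq_bigr => l _; rewrite rmorphM /=; ring.
  rewrite exchange_big /=; apply: eq_bigr => k _.
  rewrite exchange_big mulr_sumr /=; apply: eq_bigr => l _.
  by rewrite !mulr_sumr; apply: eq_bigr => i _; rewrite !mxE.
rewrite -sumrB; apply: eq_bigr => k _.
rewrite (bigD1 k) //= inner_self unit_Phi mulrDr expr1n mulr1.
by rewrite [_^*%R * y k 0]mulrC mul_conj addrAC subrr add0r.
Qed.

Lemma energy_deviation {R : realType} {M N : nat} (Phi : 'M[R[i]]_(M, N))
    (y : 'cV[R[i]]_N) (s : 'S_N) :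
  (forall i : 'I_N, norm2 (col i Phi) = 1) ->
  `|norm2 (Phi *m row_perm s^-1 y) ^+ 2 - norm2 y ^+ 2| <=
  \sum_(k < N) cmod (y k 0) * cmod (interference Phi y s k).
Proof.
move=> unit_Phi; rewrite -cmod_real energy_expand //.
apply: le_trans (cmod_sum _ _ _) _; apply: ler_sum => k _.
by rewrite cmodM cmod_conj.
Qed.

Lemma sqr_sum_le_card {R : realType} {T : finType} (A : {set T}) (a : T -> R) :
  (\sum_(i in A) a i) ^+ 2 <= #|A|%:R * \sum_(i in A) a i ^+ 2.
Proof.
set S := \sum_(i in A) a i; set Q := \sum_(i in A) a i ^+ 2.
have [A0|A0] := posnP #|A|.
  by rewrite /S /Q (cards0_eq A0) !big_set0 expr0n cards0 mul0r.
have : 0 <= \sum_(i in A) (#|A|%:R * a i - S) ^+ 2.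
  by apply: sumr_ge0 => i _; exact: sqr_ge0.
have -> : \sum_(i in A) (#|A|%:R * a i - S) ^+ 2 =
    #|A|%:R * (#|A|%:R * Q - S ^+ 2).
  transitivity (\sum_(i in A) (#|A|%:R ^+ 2 * a i ^+ 2 +
      - (2 * #|A|%:R * S) * a i + S ^+ 2)).
    by apply: eq_bigr => i _; ring.
  rewrite 2!big_split /= -!mulr_sumr sumr_const -/S -/Q -mulr_natl; ring.
by rewrite pmulr_rge0 ?ltr0n // subr_ge0.
Qed.

(** * Coherence bounds *)

Lemma worst_case_coherence_ge0 {R : realType} {M N : nat}
    (Phi : 'M[R[i]]_(M, N)) : 0 <= worst_case_coherence Phi.
Proof. exact: bigmax_ge_id. Qed.

Lemma inner_le_coherence {R : realType} {M N : nat} (Phi : 'M[R[i]]_(M, N))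
    (u v : 'I_N) : u != v ->
  cmod (inner (col u Phi) (col v Phi)) <= worst_case_coherence Phi.
Proof.
move=> uv.
exact: (@le_bigmax_cond _ _ _ 0 (u, v) (fun ij : 'I_N * 'I_N => ij.1 != ij.2)
  (fun ij => cmod (inner (col ij.1 Phi) (col ij.2 Phi)))).
Qed.

Lemma inner_sym {R : realType} {n : nat} (u v : 'cV[R[i]]_n) :
  inner u v = (inner v u)^*%R.
Proof.
rewrite /inner rmorph_sum; apply: eq_bigr => k _.
by rewrite rmorphM /= conjCK mulrC.
Qed.

Lemma mean_inner_le_coherence {R : realType} {M N : nat}
    (Phi : 'M[R[i]]_(M, N)) (t : 'I_N) :
  cmod (N.-1%:R^-1 * \sum_(u < N | u != t) inner (col u Phi) (col t Phi)) <=
  average_coherence Phi.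
Proof.
rewrite -cmod_conj rmorphM /= fmorphV rmorph_nat rmorph_sum /=.
under eq_bigr do rewrite -inner_sym.
exact: (@le_bigmax_cond _ _ _ 0 t xpredT (fun i =>
  cmod (N.-1%:R^-1 * \sum_(j < N | j != i) inner (col i Phi) (col j Phi)))).
Qed.

(** Conditionally on [s k = t], this bounds the mean of each summand of the
    interference; the modulus is bounded only after averaging, which is why the
    average coherence appears and not the worst-case one. *)
Lemma average_Re_inner_le {R : realType} {M N : nat}
    (Phi : 'M[R[i]]_(M, N)) (c : R[i]) (t : 'I_N) :
  average (~: [set t])
    (fun u => complex.Re (c * inner (col u Phi) (col t Phi))) <=
  cmod c * average_coherence Phi.
Proof.
set mean := N.-1%:R^-1 * \sum_(u < N | u != t) inner (col u Phi) (col t Phi).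
have -> : average (~: [set t])
    (fun u => complex.Re (c * inner (col u Phi) (col t Phi))) =
    complex.Re (c * mean).
  rewrite /average -Re_sum -mulr_sumr cardsC1 card_ord /mean.
  have -> : N.-1%:R^-1 = (N.-1%:R^-1)%:C :> R[i].
    by rewrite fmorphV rmorph_nat.
  under eq_bigl do rewrite !inE.
  move: (\sum_(_ < N | _) _) => -[x y]; case: c => p q /=; ring.
apply: le_trans (ler_norm _) _; apply: le_trans (Re_le_cmod _) _.
by rewrite cmodM ler_wpM2l ?cmod_ge0 // mean_inner_le_coherence.
Qed.

(** * Vectors with small support *)

Definition support {R : realType} {N : nat} (y : 'cV[R[i]]_N) : {set 'I_N} :=
  [set l | y l 0 != 0].

Lemma sum_support {R : realType} {N : nat} (y : 'cV[R[i]]_N) (A : pred 'I_N)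
    (V : zmodType) (F : 'I_N -> V) : (forall l, y l 0 = 0 -> F l = 0) ->
  \sum_(l < N | A l) F l = \sum_(l in support y | A l) F l.
Proof.
move=> F0; rewrite big_mkcond [RHS]big_mkcond /=; apply: eq_bigr => l _.
rewrite inE; have [yl|_] := eqVneq (y l 0) 0; last by [].
by rewrite F0 //; case: ifP.
Qed.

Lemma sum_cmod_support {R : realType} {N K : nat} (y : 'cV[R[i]]_N) :
  (#|support y| <= K)%N ->
  \sum_(l in support y) cmod (y l 0) <= Num.sqrt K%:R * norm2 y.
Proof.
move=> yK; rewrite -(ler_pXn2r (n := 2)) ?nnegrE //; last first.
- by rewrite mulr_ge0 ?sqrtr_ge0.
- by rewrite sumr_ge0 // => l _; exact: cmod_ge0.
apply: le_trans (sqr_sum_le_card _ _) _.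
rewrite exprMn sqr_sqrtr // norm2_sqr; apply: ler_pM => //.
- by apply: sumr_ge0 => l _; exact: sqr_ge0.
- by rewrite ler_nat.
rewrite [leRHS](bigID (mem (support y))) /= lerDl.
by apply: sumr_ge0 => l _; exact: sqr_ge0.
Qed.

(** * Interference is small with high probability *)

(** With [X = mu * norm2 y], the bound [linear_statistic_tail] is used with the
    tilt [lam = ell / (3 * X)] and the drift bound [b = X / (7 * sqrt K)], which
    is admissible since at least [7 * K] columns remain free.  The mean
    contributes at most [X / ell <= X * ell / 8], hence [ell ^+ 2 / 24] to the
    exponent; the threshold [7 * ell * X] contributes [- 7 / 3 * ell ^+ 2]; the
    variance term is at most [8 / 9 * (1 + 1 / 7) ^+ 2 * ell ^+ 2].  The sum is
    smaller than [- ell ^+ 2]. *)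
Lemma interference_tail {R : realType} {M N K : nat} (Phi : 'M[R[i]]_(M, N))
    (y : 'cV[R[i]]_N) (k : 'I_N) (w : R[i]) (ell : R) :
  (#|support y| <= K)%N -> k \in support y -> cmod w = 1 ->
  0 < ell -> 8 <= ell ^+ 2 -> (8 * K <= N)%N ->
  average_coherence Phi * Num.sqrt K%:R * ell <= worst_case_coherence Phi ->
  #|[set s : 'S_N | 7 * ell * (worst_case_coherence Phi * norm2 y) <
       complex.Re (w * interference Phi y s k)]|%:R <
  #|'S_N|%:R * expR (- ell ^+ 2).
Proof.
move=> yK ky w1 ell0 ell8 KN hnu.
set mu := worst_case_coherence Phi in hnu *; set B := norm2 y.
set nu := average_coherence Phi in hnu.
have mu0 : 0 <= mu := worst_case_coherence_ge0 Phi.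
have B0 : 0 <= B by exact: sqrtr_ge0.
have nu0 : 0 <= nu by exact: bigmax_ge_id.
have perm0 : 0 < #|'S_N|%:R :> R.
  by rewrite ltr0n; apply/card_gt0P; exists 1%g.
pose L := enum (support y :\ k).
pose a l u t : R := complex.Re (w * y l 0 * inner (col u Phi) (col t Phi)).
have ReE (s : 'S_N) : complex.Re (w * interference Phi y s k) =
    \sum_(l <- L) a l (s l) (s k).
  rewrite big_enum /interference (sum_support y) => [|l ->]; last first.
    by rewrite mul0r.
  rewrite mulr_sumr Re_sum; apply: eq_big => [l|l _].
    by rewrite !inE andbC.
  by rewrite /a mulrA.
have kL : k \notin L by rewrite mem_enum setD11.
have sizeL : (size L < K)%N.
  by rewrite /L -cardE; move: yK; rewrite (cardsD1 k) ky add1n.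
have am : {in L, forall l u t, u != t -> `|a l u t| <= mu * cmod (y l 0)}.
  move=> l _ u t ut; apply: le_trans (Re_le_cmod _) _.
  rewrite !cmodM w1 mul1r mulrC ler_wpM2r ?cmod_ge0 //.
  exact: inner_le_coherence.
have -> : [set s : 'S_N | 7 * ell * (mu * B) <
      complex.Re (w * interference Phi y s k)] =
    [set s : 'S_N | 7 * ell * (mu * B) < \sum_(l <- L) a l (s l) (s k)].
  by apply/setP => s; rewrite !inE ReE.
(* When [mu * B = 0] the tilt is undefined, but then every summand vanishes and
   the strict inequality defining the event fails. *)
have [X0|X0] := leP (mu * B) 0.
  have X00 : mu * B = 0 by apply/le_anti; rewrite X0 mulr_ge0.
  rewrite X00 mulr0.
  have y_small l : mu * cmod (y l 0) <= 0.
    rewrite -X00 ler_wpM2l // -(ler_pXn2r (n := 2)) ?nnegrE ?cmod_ge0 //.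
    rewrite norm2_sqr (bigD1 l) //= lerDl.
    by apply: sumr_ge0 => j _; exact: sqr_ge0.
  rewrite (_ : [set s : 'S_N | _] = set0) ?cards0 ?mulr_gt0 ?expR_gt0 //.
  apply/setP => s; rewrite !inE; apply/negbTE; rewrite -leNgt.
  rewrite big_seq; apply: sumr_le0 => l lL.
  apply: le_trans (ler_norm _) _; apply: le_trans (y_small l).
  apply: am; rewrite // (inj_eq perm_inj).
  by apply: contraNneq kL => <-.
have K0 : (0 < K)%N by exact: leq_ltn_trans sizeL.
pose k0 : R := Num.sqrt K%:R.
have k00 : 0 < k0 by rewrite sqrtr_gt0 ltr0n.
have k0K : k0 ^+ 2 = K%:R by rewrite sqr_sqrtr.
pose b := mu * B / (7 * k0).
have b0 : 0 < b by apply: divr_gt0 => //; rewrite mulr_gt0.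
have bk0 : 7 * (b * k0) = mu * B by rewrite /b; field; rewrite gt_eqF.
pose Y1 := \sum_(l <- L) cmod (y l 0).
have Y1_ge0 : 0 <= Y1 by apply: sumr_ge0 => l _; exact: cmod_ge0.
have Y1_le : Y1 <= k0 * B.
  apply: le_trans (sum_cmod_support _ yK).
  rewrite [leRHS](big_setD1 k ky) /= /Y1 big_enum lerDr.
  exact: cmod_ge0.
pose Y2 := \sum_(l <- L) cmod (y l 0) ^+ 2.
have Y2_le : Y2 <= B ^+ 2.
  rewrite norm2_sqr [leRHS](bigID (mem (support y :\ k))) /= /Y2 big_enum lerDl.
  by apply: sumr_ge0 => l _; exact: sqr_ge0.
have sizeLR : (size L)%:R + 1 <= K%:R :> R by rewrite natr1 ler_nat.
have KNR : 8 * K%:R <= N%:R :> R by rewrite -natrM ler_nat.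
pose lam := ell / (3 * (mu * B)).
have lam0 : 0 < lam by apply: divr_gt0 => //; rewrite pmulr_rgt0.
have lamX : 3 * (lam * (mu * B)) = ell.
  by rewrite /lam; move: (mu * B) (lt0r_neq0 X0) => X X1; field.
have := linear_statistic_tail L k a (fun l => mu * cmod (y l 0))
  (fun l => nu * cmod (y l 0)) b lam (7 * ell * (mu * B)) (enum_uniq _) kL
  (ltW b0) (ltW lam0).
rewrite -!mulr_sumr -/Y1 card_ord => tail.
apply: le_lt_trans (tail _ am _) _.
- apply: (@le_trans _ _ (mu * (k0 * B))); first by rewrite ler_wpM2l.
  have -> : mu * (k0 * B) = b * (7 * K%:R) by rewrite mulrCA -bk0 -k0K; ring.
  rewrite ler_pM2l //; lra.
- move=> l _ t; apply: le_trans (average_Re_inner_le _ _ _) _.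
  by rewrite cmodM w1 mul1r mulrC.
rewrite ltr_pM2l // ltr_expR.
have -> : \sum_(l <- L) (mu * cmod (y l 0) + b) ^+ 2 =
    mu ^+ 2 * Y2 + 2 * b * mu * Y1 + (size L)%:R * b ^+ 2.
  transitivity (\sum_(l <- L) (mu ^+ 2 * cmod (y l 0) ^+ 2 +
      2 * b * mu * cmod (y l 0) + b ^+ 2)).
    by apply: eq_bigr => l _; ring.
  rewrite !big_split /= -2!mulr_sumr -/Y1 -/Y2.
  by congr (_ + _); rewrite big_const_seq count_predT iter_addr_0 mulr_natl.
have V_le : mu ^+ 2 * Y2 + 2 * b * mu * Y1 + (size L)%:R * b ^+ 2 <=
    (64 / 49) * (mu * B) ^+ 2.
  have h1 : mu ^+ 2 * Y2 <= (mu * B) ^+ 2.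
    by rewrite exprMn ler_wpM2l ?sqr_ge0.
  have h2 : 2 * b * mu * Y1 <= (2 / 7) * (mu * B) ^+ 2.
    apply: le_trans (ler_wpM2l _ Y1_le) _.
      by apply: mulr_ge0 => //; apply: mulr_ge0 => //; exact: ltW.
    have -> : 2 * b * mu * (k0 * B) = 2 * (b * k0) * (mu * B) by ring.
    by rewrite -bk0; set z := b * k0; nra.
  have h3 : (size L)%:R * b ^+ 2 <= (1 / 49) * (mu * B) ^+ 2.
    apply: (@le_trans _ _ (K%:R * b ^+ 2)).
      by rewrite ler_wpM2r ?sqr_ge0 //; lra.
    by rewrite -k0K -bk0 -exprMn [k0 * b]mulrC; set z := b * k0; nra.
  lra.
have mean_le : lam * (nu * Y1) <= ell ^+ 2 / 24.
  have h1 : nu * Y1 * ell <= mu * B.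
    apply: le_trans (_ : nu * k0 * ell * B <= _); last by rewrite ler_wpM2r.
    have -> : nu * k0 * ell * B = nu * (k0 * B) * ell by ring.
    by rewrite ler_wpM2r ?(ltW ell0) // ler_wpM2l.
  have h2 : lam * (nu * Y1) * ell * 3 <= ell.
    have -> : lam * (nu * Y1) * ell * 3 = 3 * (lam * (nu * Y1 * ell)) by ring.
    by rewrite -[leRHS]lamX ler_wpM2l // ler_wpM2l // ltW.
  have h3 : 0 <= lam * (nu * Y1) by rewrite mulr_ge0 ?(ltW lam0) // mulr_ge0.
  have : lam * (nu * Y1) * 3 <= 1 by nra.
  lra.
have thr_eq : lam * (7 * ell * (mu * B)) = 7 / 3 * ell ^+ 2.
  by rewrite expr2 -[X in _ = _ * (X * _)]lamX; field.
have V_le' : 8 * lam ^+ 2 *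
    (mu ^+ 2 * Y2 + 2 * b * mu * Y1 + (size L)%:R * b ^+ 2) <=
    512 / 441 * ell ^+ 2.
  apply: le_trans (ler_wpM2l _ V_le) _; first by rewrite mulr_ge0 ?sqr_ge0.
  rewrite -lamX; set z := mu * B; lra.
rewrite mulrBr thr_eq; lra.
Qed.

Definition phases {R : realType} : seq R[i] := [:: 1; -1; 'i; - 'i].

Lemma cmod_phase {R : realType} (w : R[i]) : w \in phases -> cmod w = 1.
Proof.
rewrite !inE /cmod => /or4P[] /eqP ->; rewrite ?normcN;
  by rewrite /= !(expr0n, expr1n, addr0, add0r) sqrtr1.
Qed.

(** The four conditions bound the real and imaginary parts by [7 * c] in
    absolute value, and [7 ^+ 2 + 7 ^+ 2 <= 10 ^+ 2]. *)
Lemma cmod_le_phases {R : realType} (z : R[i]) (c : R) : 0 <= c ->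
  {in phases, forall w, complex.Re (w * z) <= 7 * c} -> cmod z <= 10 * c.
Proof.
move=> c0 zc.
have := zc 1; have := zc (-1); have := zc 'i; have := zc (- 'i).
rewrite !inE !eqxx ?orbT => /(_ isT) h1 /(_ isT) h2 /(_ isT) h3 /(_ isT) h4.
rewrite -(ler_pXn2r (n := 2)) ?nnegrE ?cmod_ge0 ?mulr_ge0 // cmod_sqr.
case: z {zc} h1 h2 h3 h4 => p q /=.
rewrite !(mul0r, mul1r, mulN1r, oppr0, subr0, sub0r, addr0, add0r, mulNr, opprK).
move=> h1 h2 h3 h4; nra.
Qed.

(** * The weak restricted isometry property *)

Lemma card_bigcup_le {T : finType} {I : Type} (r : seq I) (P : pred I)
    (F : I -> {set T}) :
  (#|\bigcup_(i <- r | P i) F i| <= \sum_(i <- r | P i) #|F i|)%N.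
Proof.
apply: (big_ind2 (fun (A : {set T}) n => #|A| <= n)%N) => [|A m B n Am Bn|//].
  by rewrite cards0.
by apply: leq_trans (leq_add Am Bn); rewrite leq_card_setU.
Qed.

Lemma ln_ge4 {R : realType} (N : nat) : (128 <= N)%N -> 4 <= ln N%:R :> R.
Proof.
move=> N128; have N0 : 0 < N%:R :> R by rewrite ltr0n; lia.
rewrite -ler_expR lnK ?posrE //.
apply: (@le_trans _ _ 128%:R); last by rewrite ler_nat.
rewrite -[leLHS]invrK -expRN -[leRHS]invrK lef_pV2 ?posrE ?invr_gt0 ?expR_gt0 //.
(* [exp (- 4)] is the 14th power of [exp (- 2 / 7) >= 5 / 7], and
   [(5 / 7) ^+ 14 >= 1 / 128]. *)
have -> : - 4 = (- (2 / 7)) * 14%:R :> R by field.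
rewrite expRM_natr.
apply: (@le_trans _ _ ((5 / 7) ^+ 14)); first by lra.
rewrite lerXn2r ?nnegrE ?expR_ge0 //; first by lra.
by apply: le_trans (expR_ge1Dx _); lra.
Qed.

Lemma energy_deviation_le {R : realType} {M N K : nat} (Phi : 'M[R[i]]_(M, N))
    (y : 'cV[R[i]]_N) (s : 'S_N) (c : R) :
  (forall i : 'I_N, norm2 (col i Phi) = 1) ->
  (#|support y| <= K)%N -> 0 <= c ->
  {in support y, forall k, cmod (interference Phi y s k) <= c * norm2 y} ->
  `|norm2 (Phi *m row_perm s^-1 y) ^+ 2 - norm2 y ^+ 2| <=
  Num.sqrt K%:R * c * norm2 y ^+ 2.
Proof.
move=> unit_Phi yK c0 Ic; apply: le_trans (energy_deviation _ _ _ unit_Phi) _.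
rewrite (sum_support y) => [|l ->]; last by rewrite /cmod normc0 mul0r.
have B0 : 0 <= norm2 y by exact: sqrtr_ge0.
apply: (@le_trans _ _ (\sum_(k in support y) cmod (y k 0) * (c * norm2 y))).
  rewrite [leLHS](eq_bigl (mem (support y))) => [|k]; last by rewrite andbT.
  by apply: ler_sum => k ky; rewrite ler_wpM2l ?cmod_ge0 ?Ic.
rewrite -mulr_suml.
have -> : Num.sqrt K%:R * c * norm2 y ^+ 2 =
  Num.sqrt K%:R * norm2 y * (c * norm2 y) by ring.
by rewrite ler_wpM2r ?mulr_ge0 ?sum_cmod_support.
Qed.

Local Close Scope complex_scope.

Theorem theorem45 (R : realType) (M N K : nat) (delta : R)
    (Phi : 'M[R[i]]_(M, N))
    (hframe : unit_norm_frame Phi)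
    (hcoh : strong_coherence Phi)
    (hN : (128 <= N)%N)
    (hK : (0 < K)%N)
    (hdelta : 0 < delta)
    (hsparse : ((2 * K%:R * ln N%:R)%:E <= sparsity_bound Phi delta)%E) :
  weak_RIP Phi K delta (4 * K%:R / N%:R ^+ 2).
Proof.
case: hframe => MN _ unit_Phi; case: hcoh => _ hnu.
have mu0 := worst_case_coherence_ge0 Phi.
move: hsparse; rewrite /sparsity_bound le_min lee_fin => /andP[hsp KM].
set mu := worst_case_coherence Phi in hnu mu0 hsp.
have lnN := ln_ge4 (R := R) N hN.
have N0 : 0 < N%:R :> R by rewrite ltr0n; lia.
have K1 : 1 <= K%:R :> R by rewrite (ler_nat _ 1).
pose ell : R := Num.sqrt (2 * ln N%:R).
have ellE : ell ^+ 2 = 2 * ln N%:R by rewrite sqr_sqrtr //; lra.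
have ell0 : 0 < ell by rewrite sqrtr_gt0; lra.
have ell8 : 8 <= ell ^+ 2 by lra.
have KN : (8 * K <= N)%N.
  rewrite -(ler_nat R) natrM; apply: (@le_trans _ _ M%:R).
    by apply: le_trans KM; nra.
  by rewrite ler_nat.
pose k0 : R := Num.sqrt K%:R.
have k0K : k0 ^+ 2 = K%:R by rewrite sqr_sqrtr.
have k00 : 0 <= k0 := sqrtr_ge0 _.
(* After squaring this is the first half of the sparsity hypothesis. *)
have hdel : k0 * (10 * (ell * mu)) <= delta.
  rewrite -(ler_pXn2r (n := 2)) ?nnegrE ?(ltW hdelta) ?mulr_ge0 ?(ltW ell0) //.
  rewrite !exprMn k0K ellE.
  have [->|mu_neq0] := eqVneq mu 0; first by rewrite expr0n !mulr0 sqr_ge0.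
  have D0 : 0 < 100 * mu ^+ 2.
    by rewrite mulr_gt0 // exprn_gt0 // lt0r mu_neq0.
  move: hsp; rewrite inver gt_eqF // -EFinM lee_fin ler_pdivlMr //.
  lra.
have M0 : 0 < M%:R :> R by apply: lt_le_trans KM; nra.
(* The average coherence is at most [mu / sqrt M], and
   [sqrt K * ell <= sqrt M] because [2 * K * ln N <= M]. *)
have hmean : average_coherence Phi * k0 * ell <= mu.
  have hM : k0 * ell <= Num.sqrt M%:R.
    rewrite -(ler_pXn2r (n := 2)) ?nnegrE ?sqrtr_ge0 ?mulr_ge0 ?(ltW ell0) //.
    rewrite exprMn k0K ellE sqr_sqrtr // ; lra.
  move: hnu; rewrite ler_pdivlMr ?sqrtr_gt0 // => hnu.
  apply: le_trans hnu; rewrite -mulrA ler_wpM2l //; exact: bigmax_ge_id.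
move=> y; rewrite -/(support y) => yK.
pose E k w := [set s : 'S_N | 7 * ell * (mu * norm2 y) <
  complex.Re (w * interference Phi y s k)].
pose U := \bigcup_(k in support y) \bigcup_(w <- phases) E k w.
have perm0 : 0 < #|'S_N|%:R :> R.
  by rewrite ltr0n; apply/card_gt0P; exists 1%g.
pose q : R := #|'S_N|%:R * expR (- ell ^+ 2).
have q0 : 0 < q by rewrite mulr_gt0 ?expR_gt0.
have U_small : #|U|%:R < 4 * K%:R * q.
  apply: (@le_lt_trans _ _ (\sum_(k in support y) \sum_(w <- phases)
      #|E k w|%:R)).
    rewrite -[leRHS](eq_bigr _ (fun k _ => natr_sum _ _ _ _)) -natr_sum ler_nat.
    apply: leq_trans (card_bigcup_le _ _ _) _; apply: leq_sum => k _.
    exact: card_bigcup_le.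
  have [y0|[j jy]] := set_0Vmem (support y).
    by rewrite y0 big_set0 mulr_gt0 // mulr_gt0 // ltr0n.
  apply: (@lt_le_trans _ _ (\sum_(k in support y) 4 * q)); last first.
    rewrite sumr_const -[leLHS]mulr_natl mulrA [_ * 4]mulrC ler_wpM2r ?(ltW q0) //.
    by rewrite ler_wpM2l // ler_nat.
  apply: ltr_sum => [|k ky]; first by apply/hasP; exists j; rewrite ?mem_index_enum.
  have E_small w : w \in phases -> #|E k w|%:R < q.
    move=> /cmod_phase w1; exact: (interference_tail _ _ _ _ _ yK).
  rewrite /phases !big_cons big_nil.
  have := E_small 1; have := E_small (-1).
  have := E_small 'i%C; have := E_small (- 'i%C).
  rewrite !inE !eqxx ?orbT => /(_ isT) h1 /(_ isT) h2 /(_ isT) h3 /(_ isT) h4.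
  lra.
set good := [set s : 'S_N | _].
(* Inversion maps the complement of the exceptional set into the good set. *)
have good_big : (#|~: U| <= #|good|)%N.
  rewrite -(card_imset _ (@invg_inj _)); apply/subset_leq_card/subsetP => x.
  case/imsetP => s sU -> {x}; rewrite inE /= norm2_row_perm.
  have : `|norm2 (Phi *m row_perm s^-1 y) ^+ 2 - norm2 y ^+ 2| <=
      delta * norm2 y ^+ 2.
    apply: (@le_trans _ _ (k0 * (10 * (ell * mu)) * norm2 y ^+ 2)).
      apply: energy_deviation_le => // [|k ky].
        by rewrite !mulr_ge0 ?(ltW ell0).
      rewrite -!mulrA; apply: cmod_le_phases.
        by rewrite !mulr_ge0 ?sqrtr_ge0 ?(ltW ell0).
      move=> w wP; rewrite leNgt; apply/negP; rewrite !mulrA => Ew.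
      move: sU; rewrite inE => /negP; apply; apply/bigcupP; exists k => //.
      rewrite (big_rem w) //= inE; apply/orP; left; rewrite inE.
      by rewrite !mulrA.
    by rewrite ler_wpM2r ?sqr_ge0.
  rewrite ler_norml => /andP[h1 h2]; apply/andP; split; lra.
rewrite /uniform_prob ltr_pdivlMr //.
have : #|U|%:R + #|~: U|%:R = #|'S_N|%:R :> R by rewrite -natrD cardsC.
have : #|~: U|%:R <= #|good|%:R :> R by rewrite ler_nat.
have : 4 * K%:R / N%:R ^+ 2 * #|'S_N|%:R = 4 * K%:R * q.
  rewrite /q ellE expRN -[2]/(2%:R) expRM_natl lnK ?posrE //.
  by field; rewrite gt_eqF.
rewrite mulrBl mul1r; lra.
Qed.
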